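(* Let $\mathrm{OST}_n$ be the (unbiased) one-sided transposition shuffle on $S_n$ and $\pi_n$ the uniform distribution on $S_n$. For any $c_1>0$ and $c_2>2$, $$\limsup_{n\to\infty}\bigl\lVert \mathrm{OST}_n^{\,n\log n+c_1 n}-\pi_n\bigr\rVert_{\mathrm{TV}}\le \sqrt2\,e^{-c_1},$$ $$\liminf_{n\to\infty}\bigl\lVert \mathrm{OST}_n^{\,n\log n-n\log\log n-c_2 n}-\pi_n\bigr\rVert_{\mathrm{TV}}\ge 1-\frac{\pi^2}{6(c_2-2)^2}.$$ Thus, the one-sided transposition shuffle exhibits a cutoff (in total variation distance) at time $n\log n$ with a window of order $n\log\log n$.
   Context: $[n]=\{1,\dots,n\}$. The unbiased one-sided transposition shuffle is the random walk on $S_n$ driven by the probability distribution $\mathrm{OST}_n((i\,j))=\frac1n\cdot\frac1j$ for $1\le i\le j\le n$, and $0$ on all other elements, where every $(i\,i)$ is read as the identity $e$ (so $\mathrm{OST}_n(e)=H_n/n$ with $H_n=\sum_{k=1}^n 1/k$). Equivalently, the right hand picks a position $j$ uniformly in $[n]$, the left hand picks $i$ uniformly in $\{1,\dots,j\}$, and $(i\,j)$ is applied. For a probability $P$ on a finite group $G$, the random walk driven by $P$, started at the identity, is $X^{t+1}=\xi^{t+1}X^t$ with $\xi^t$ i.i.d. of law $P$. $P^t$ denotes the $t$-fold convolution of $P$ (the law of $X^t$); for a real $s\ge0$, $P^s$ means $P^{\lfloor s\rfloor}$. Total variation distance: $\lVert\mu-\nu\rVert_{\mathrm{TV}}=\sup_{A\subseteq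 G}|\mu(A)-\nu(A)|=\frac12\sum_{g\in G}|\mu(g)-\nu(g)|$. Cutoff: a sequence of random walks $P_n$ on finite groups $G_n$ with stationary distributions $\pi_n$ exhibits a total variation cutoff at time $t_n$ with a window of size $w_n$ if $w_n=o(t_n)$, $\lim_{c\to\infty}\limsup_{n\to\infty}\lVert P_n^{t_n+cw_n}-\pi_n\rVert_{\mathrm{TV}}=0$ and $\lim_{c\to\infty}\liminf_{n\to\infty}\lVert P_n^{t_n-cw_n}-\pi_n\rVert_{\mathrm{TV}}=1$. *)

(* Defs.v *)
From HB Require Import structures.
From mathcomp Require Import all_boot all_order all_algebra all_fingroup.
From mathcomp Require Import all_classical all_reals all_analysis.
Set Implicit Arguments.
Unset Strict Implicit.
Unset Printing Implicit Defensive.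
Import Order.TTheory GRing.Theory Num.Theory.
Import numFieldNormedType.Exports.
Local Open Scope classical_set_scope.
Local Open Scope ring_scope.

(* Measures on a finite group are given by mass functions. *)

(* [convolution P Q] is the law of xi * X for independent xi ~ P and X ~ Q. *)
Definition convolution (R : realType) (gT : finGroupType) (P Q : gT -> R) :
  gT -> R := fun g => \sum_(h : gT) P h * Q (h^-1 * g)%g.

Definition convolution_pow (R : realType) (gT : finGroupType) (P : gT -> R)
  (t : nat) : gT -> R := iter t (convolution P) (fun g => (g == 1%g)%:R).

(* [Num.truncn s] is the floor of s when s >= 0, and 0 when s < 0. *)
Definition convolution_rpow (R : realType) (gT : finGroupType) (P : gT -> R)
  (s : R) : gT -> R := convolution_pow P (Num.truncn s).

Definition tv_dist (R : realType) (gT : finGroupType) (mu nu : gT -> R) : R :=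
  \big[Num.max/0]_(A : {set gT})
    `| \sum_(g in A) mu g - \sum_(g in A) nu g |.

Definition uniform_dist (R : realType) (gT : finGroupType) : gT -> R :=
  fun _ => #|gT|%:R^-1.
Arguments uniform_dist R {gT} _.

(* Positions are numbered from 0, so the position j of the right hand is
   [j.+1] in the usual numbering. All the pairs (i, i) contribute to the mass
   of the identity, since [tperm i i = 1]. MathComp composes permutations from
   left to right, which does not affect convolution powers of a single law. *)
Definition OST (R : realType) (n : nat) : {perm 'I_n} -> R := fun s =>
  \sum_(j < n) \sum_(i < n | (i <= j)%N && (tperm i j == s))
    n%:R^-1 * j.+1%:R^-1.
Arguments OST R n _ : clear implicits.

(* Limits superior and inferior are taken in [\bar R], where they always
   exist. *)
Definition tv_cutoff (R : realType) (gT : nat -> finGroupType)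
    (P pi_ : forall n, gT n -> R) (t w : nat -> R) : Prop :=
  [/\ w =o_\oo t,
      limn_esup (fun n =>
        (tv_dist (convolution_rpow (P n) (t n + c * w n)) (pi_ n))%:E)
        @[c --> +oo] --> 0%:E
    & limn_einf (fun n =>
        (tv_dist (convolution_rpow (P n) (t n - c * w n)) (pi_ n))%:E)
        @[c --> +oo] --> 1%:E].
Arguments tv_cutoff {R} gT _ _ _ _.

(* Main.v *)
Require Import Defs.
From HB Require Import structures.
From mathcomp Require Import all_boot all_order all_algebra all_fingroup.
From mathcomp Require Import all_classical all_reals all_analysis.
From mathcomp Require Import ring lra zify.
Import Order.TTheory GRing.Theory Num.Theory.
Import numFieldNormedType.Exports.
Local Open Scope classical_set_scope.
Local Open Scope ring_scope.

(* Upper bound. With R_j the uniform law on the transpositions (i j), i <= j,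
   the shuffle is the average of the R_j. The R_j commute and their product over
   all j is uniform, so a word R_(j_1) ... R_(j_t) containing every j is exactly
   uniform: the distance is at most the probability that t uniform draws miss
   some position, hence at most n (1 - 1/n)^t.

   Lower bound. Among the top k ~ n / log n positions, let N be the number of
   those that neither hand has visited; they are fixed points. A given one of
   them is visited with probability at most 1 / (n - k) per step, and two such
   events are almost independent, so the second moment method gives
   P(N = 0) <= 1 / E N + o(1), while a uniform permutation fixes one of these
   positions with probability at most k / n. At time n log n - n log log n - c n,
   E N is asymptotically at least exp (c - 1), which beats the claimed bound. *)

(** * Laws and words on a finite group *)

Lemma tv_dist_le {R : realType} {gT : finGroupType} (mu nu : gT -> R) (b : R) :
  (forall A : {set gT}, `|\sum_(g in A) mu g - \sum_(g in A) nu g| <= b) ->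
  tv_dist mu nu <= b.
Proof.
move=> H; apply: bigmax_le => [|A _]; last exact: H.
exact: le_trans (normr_ge0 _) (H finset.set0).
Qed.

Lemma tv_dist_ge {R : realType} {gT : finGroupType} (mu nu : gT -> R)
    (A : {set gT}) :
  `|\sum_(g in A) mu g - \sum_(g in A) nu g| <= tv_dist mu nu.
Proof.
exact: (le_bigmax 0
  (fun A : {set gT} => `|\sum_(g in A) mu g - \sum_(g in A) nu g|) A).
Qed.

Lemma tv_dist_ge0 {R : realType} {gT : finGroupType} (mu nu : gT -> R) :
  0 <= tv_dist mu nu.
Proof. exact: le_trans (normr_ge0 _) (tv_dist_ge mu nu finset.set0). Qed.

Definition is_law {R : realType} {T : finType} (p : T -> R) : Prop :=
  (forall x, 0 <= p x) /\ \sum_x p x = 1.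

Lemma is_law_set_itv {R : realType} {T : finType} (p : T -> R) (A : {set T}) :
  is_law p -> 0 <= \sum_(g in A) p g <= 1.
Proof.
move=> [p0 p1]; rewrite sumr_ge0//= -p1.
rewrite [leRHS](bigID (fun x => x \in A))/= lerDl.
exact: sumr_ge0.
Qed.

Lemma dist_itv01 {R : realType} (a b : R) :
  0 <= a <= 1 -> 0 <= b <= 1 -> `|a - b| <= 1.
Proof. by move=> ? ?; rewrite ler_norml; lra. Qed.

Lemma tv_dist_le1 {R : realType} {gT : finGroupType} (mu nu : gT -> R) :
  is_law mu -> is_law nu -> tv_dist mu nu <= 1.
Proof.
by move=> mul nul; apply: tv_dist_le => A; apply: dist_itv01;
  exact: is_law_set_itv.
Qed.

Lemma uniform_dist_law (R : realType) (gT : finGroupType) :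
  is_law (@uniform_dist R gT).
Proof.
split=> [x|]; first by rewrite invr_ge0.
rewrite sumr_const -[_ *+ _]mulr_natr mulVf// pnatr_eq0.
by rewrite -lt0n; apply/card_gt0P; exists 1%g.
Qed.

Definition dirac_law {R : realType} {gT : finGroupType} (a : gT) : gT -> R :=
  fun g => (g == a)%:R.

Lemma dirac_law_law {R : realType} {gT : finGroupType} (a : gT) :
  is_law (dirac_law (R := R) a).
Proof.
split=> [x|]; first exact: ler0n.
by rewrite (bigD1 a)//= /dirac_law eqxx big1 ?addr0// => i /negbTE ->.
Qed.

Lemma convolution_law {R : realType} {gT : finGroupType} (P Q : gT -> R) :
  is_law P -> is_law Q -> is_law (convolution P Q).
Proof.
move=> [P0 P1] [Q0 Q1]; split=> [g|].
  by apply: sumr_ge0 => h _; exact: mulr_ge0.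
rewrite exchange_big/= -P1; apply: eq_bigr => h _.
rewrite -mulr_sumr (reindex_inj (mulgI h))/=.
under eq_bigr do rewrite mulKg.
by rewrite Q1 mulr1.
Qed.

Lemma convolutionA {R : realType} {gT : finGroupType} (P Q S : gT -> R) :
  convolution P (convolution Q S) = convolution (convolution P Q) S.
Proof.
apply/funext => g; rewrite /convolution.
under eq_bigr do rewrite mulr_sumr.
under [RHS]eq_bigr do rewrite mulr_suml.
rewrite [RHS]exchange_big/=; apply: eq_bigr => h _.
rewrite [RHS](reindex_inj (mulgI h))/=; apply: eq_bigr => k _.
by rewrite mulKg invMg !mulgA mulrA.
Qed.

Lemma convolution_dirac {R : realType} {gT : finGroupType} (a : gT)
    (P : gT -> R) : convolution (dirac_law a) P = fun g => P (a^-1 * g)%g.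
Proof.
apply/funext => g; rewrite /convolution (bigD1 a)//= /dirac_law eqxx mul1r.
by rewrite big1 ?addr0// => h /negbTE ->; rewrite mul0r.
Qed.

Lemma convolution_uniform {R : realType} {gT : finGroupType} (P : gT -> R) :
  is_law P -> convolution (uniform_dist R) P = uniform_dist R.
Proof.
move=> [_ P1]; apply/funext => g; rewrite /convolution /uniform_dist -mulr_sumr.
rewrite -[RHS]mulr1 -P1; congr (_ * _).
rewrite [RHS](reindex_inj (h := fun h => (h^-1 * g)%g))//.
by move=> x y /mulIg/invg_inj.
Qed.

(* Expectation of [h] over words of [t] independent letters of law [p]. *)
Fixpoint word_sum {R : realType} {X : finType} (p : X -> R) (t : nat)
    (h : seq X -> R) : R :=
  if t is s.+1 then \sum_x p x * word_sum p s (fun w => h (x :: w))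
  else h [::].

Lemma eq_word_sum {R : realType} {X : finType} (p : X -> R) (t : nat)
    (h k : seq X -> R) : h =1 k -> word_sum p t h = word_sum p t k.
Proof. by move=> /funext ->. Qed.

Lemma word_sum_linear {R : realType} {X : finType} (p : X -> R) (t : nat)
    {I : Type} (r : seq I) (P : pred I) (c : I -> R) (h : I -> seq X -> R) :
  word_sum p t (fun w => \sum_(i <- r | P i) c i * h i w) =
  \sum_(i <- r | P i) c i * word_sum p t (h i).
Proof.
elim: t h => [//|t IH] h /=.
under eq_bigr do rewrite (IH (fun i w => h i (_ :: w))) mulr_sumr.
rewrite exchange_big; apply: eq_bigr => i _.
by rewrite mulr_sumr; apply: eq_bigr => x _; rewrite mulrCA.
Qed.

Lemma word_sum_sum {R : realType} {X : finType} (p : X -> R) (t : nat)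
    {I : Type} (r : seq I) (P : pred I) (h : I -> seq X -> R) :
  word_sum p t (fun w => \sum_(i <- r | P i) h i w) =
  \sum_(i <- r | P i) word_sum p t (h i).
Proof.
have := word_sum_linear p t r P (fun=> 1) h.
under [RHS]eq_bigr do rewrite mul1r.
by under eq_word_sum => w do under eq_bigr do rewrite mul1r.
Qed.

Lemma word_sumZ {R : realType} {X : finType} (p : X -> R) (t : nat) (c : R)
    (h : seq X -> R) :
  word_sum p t (fun w => c * h w) = c * word_sum p t h.
Proof.
have := word_sum_linear p t [:: tt] xpredT (fun=> c) (fun=> h).
by rewrite big_seq1; under eq_word_sum do rewrite big_seq1.
Qed.

Lemma word_sumD {R : realType} {X : finType} (p : X -> R) (t : nat)
    (h k : seq X -> R) :
  word_sum p t (fun w => h w + k w) = word_sum p t h + word_sum p t k.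
Proof.
elim: t h k => [//|t IH] h k /=; rewrite -big_split/=.
by apply: eq_bigr => x _; rewrite IH mulrDr.
Qed.

Lemma word_sumB {R : realType} {X : finType} (p : X -> R) (t : nat)
    (h k : seq X -> R) :
  word_sum p t (fun w => h w - k w) = word_sum p t h - word_sum p t k.
Proof.
rewrite word_sumD; congr (_ + _); rewrite -[RHS]mulN1r -word_sumZ.
by under [RHS]eq_word_sum do rewrite mulN1r.
Qed.

Lemma word_sum_cst {R : realType} {X : finType} (p : X -> R) (t : nat) (c : R) :
  is_law p -> word_sum p t (fun=> c) = c.
Proof.
by move=> [_ p1]; elim: t => [//|t IH] /=; rewrite IH -mulr_suml p1 mul1r.
Qed.

Lemma le_word_sum {R : realType} {X : finType} (p : X -> R) (t : nat)
    (h k : seq X -> R) : is_law p -> (forall w, h w <= k w) ->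
  word_sum p t h <= word_sum p t k.
Proof.
move=> [p0 _]; elim: t h k => [|t IH] h k hk /=; first exact: hk.
by apply: ler_sum => x _; apply: ler_wpM2l => //; apply: IH => w; exact: hk.
Qed.

Lemma norm_word_sum_le {R : realType} {X : finType} (p : X -> R) (t : nat)
    (h k : seq X -> R) : is_law p -> (forall w, `|h w| <= k w) ->
  `|word_sum p t h| <= word_sum p t k.
Proof.
move=> pl hk; rewrite ler_norml; apply/andP; split.
  rewrite -mulN1r -word_sumZ; apply: le_word_sum => // w.
  by rewrite mulN1r lerNl (le_trans _ (hk w))// -normrN ler_norm.
by apply: le_word_sum => // w; rewrite (le_trans _ (hk w))// ler_norm.
Qed.

(** Independence of the letters. With [f] the indicator of a set of letters, this is the probability
    that the whole word stays in that set. *)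
Lemma word_sum_prod {R : realType} {X : finType} (p : X -> R) (t : nat)
    (f : X -> R) :
  word_sum p t (fun w => \prod_(x <- w) f x) = (\sum_x p x * f x) ^+ t.
Proof.
elim: t => [|t IH] /=; first by rewrite big_nil expr0.
under eq_bigr => x _.
  under eq_word_sum do rewrite big_cons.
  rewrite word_sumZ IH mulrA; over.
by rewrite -mulr_suml exprS.
Qed.

(** The law of a product of independent elements, one drawn from [Q x] for each letter [x] of
    [w]. *)
Definition word_law {R : realType} {gT : finGroupType} {X : Type}
    (Q : X -> gT -> R) (w : seq X) : gT -> R :=
  foldr (fun x => convolution (Q x)) (dirac_law 1%g) w.

(** Drawing the component of the mixture [P] first at each step conditions the walk on the word of
    components. This serves with two mixtures: by the right hand alone, and by both hands. *)
Lemma convolution_pow_words {R : realType} {gT : finGroupType} {X : finType}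
    (P : gT -> R) (p : X -> R) (Q : X -> gT -> R) (t : nat) (g : gT) :
  (forall h, P h = \sum_x p x * Q x h) ->
  convolution_pow P t g = word_sum p t (fun w => word_law Q w g).
Proof.
move=> PE; elim: t g => [//|t IH] g.
rewrite /convolution_pow iterS -/(convolution_pow P t) /convolution /=.
under eq_bigr do rewrite PE IH mulr_suml.
rewrite exchange_big/=; apply: eq_bigr => x _.
rewrite (word_sum_linear p t _ _ (Q x) (fun h w => word_law Q w (h^-1 * g)%g)).
by rewrite mulr_sumr; apply: eq_bigr => h _; rewrite mulrA.
Qed.

Lemma word_law_law {R : realType} {gT : finGroupType} {X : Type}
    (Q : X -> gT -> R) (w : seq X) :
  (forall x, is_law (Q x)) -> is_law (word_law Q w).
Proof.
move=> Ql; elim: w => [|x w IH] /=; first exact: dirac_law_law.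
exact: convolution_law.
Qed.

Lemma convolution_pow_law {R : realType} {gT : finGroupType} (P : gT -> R)
    (t : nat) : is_law P -> is_law (convolution_pow P t).
Proof.
move=> Pl; elim: t => [|t IH]; first exact: dirac_law_law.
exact: convolution_law.
Qed.

Lemma word_law_rem {R : realType} {gT : finGroupType} {X : eqType}
    (Q : X -> gT -> R) (w : seq X) (x : X) :
  (forall y z, convolution (Q y) (Q z) = convolution (Q z) (Q y)) ->
  x \in w -> word_law Q w = convolution (Q x) (word_law Q (rem x w)).
Proof.
move=> QC; elim: w => [//|y w IH]; rewrite inE /=.
have [->//|_ /= /IH wE] := eqVneq x y.
by rewrite wE !convolutionA QC.
Qed.

(** * Upper bound *)

(** The law of one step conditional on the right hand being at [j]. *)
Definition star_law (R : realType) {n : nat} (j : 'I_n) : {perm 'I_n} -> R :=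
  fun s => \sum_(i < n | (i <= j)%N) j.+1%:R^-1 * (tperm i j == s)%:R.

Lemma sum_star_weight (R : realType) {n : nat} (j : 'I_n) :
  \sum_(i < n | (i <= j)%N) (j.+1%:R^-1 : R) = 1.
Proof.
rewrite (big_ord_narrow (ltn_ord j))/= sumr_const card_ord.
by rewrite -[_ *+ _]mulr_natr mulVf// pnatr_eq0.
Qed.

Lemma star_law_law (R : realType) {n : nat} (j : 'I_n) :
  is_law (star_law R j).
Proof.
split=> [s|]; first by apply: sumr_ge0 => i _; rewrite mulr_ge0// invr_ge0.
rewrite exchange_big/= -[RHS](sum_star_weight R j); apply: eq_bigr => i _.
rewrite -mulr_sumr -[RHS]mulr1; congr (_ * _).
rewrite (bigD1 (tperm i j))//= eqxx big1 ?addr0// => s.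
by rewrite eq_sym => /negbTE ->.
Qed.

Lemma ord_law (R : realType) {n : nat} : (0 < n)%N ->
  is_law (fun _ : 'I_n => n%:R^-1 : R).
Proof.
move=> n0; split=> [_|]; first by rewrite invr_ge0.
by rewrite sumr_const card_ord -[_ *+ _]mulr_natr mulVf// pnatr_eq0 -lt0n.
Qed.

Lemma OST_star (R : realType) (n : nat) (s : {perm 'I_n}) :
  OST R n s = \sum_j n%:R^-1 * star_law R j s.
Proof.
rewrite /OST; apply: eq_bigr => j _; rewrite mulr_sumr big_mkcondr/=.
by apply: eq_bigr => i _; case: (_ == s); rewrite ?mulr1 ?mulr0.
Qed.

Lemma OST_law (R : realType) (n : nat) : (0 < n)%N -> is_law (OST R n).
Proof.
move=> n0; have [w0 w1] := ord_law R n0; split=> [s|].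
  rewrite OST_star; apply: sumr_ge0 => j _; apply: mulr_ge0 => //.
  exact: (star_law_law R j).1.
under eq_bigr do rewrite OST_star.
rewrite exchange_big/= -[RHS]w1; apply: eq_bigr => j _.
by rewrite -mulr_sumr (star_law_law R j).2 mulr1.
Qed.

(** As [tperm i j] fixes [k] and preserves the set of positions up to [k], conjugation by it only
    relabels the left hand. *)
Lemma star_lawJ (R : realType) {n : nat} (k i j : 'I_n) (s : {perm 'I_n}) :
  (i < k)%N -> (j < k)%N ->
  star_law R k (s ^ tperm i j)%g = star_law R k s.
Proof.
move=> ik jk; set u := tperm i j.
have uk : u k = k by rewrite /u tpermD// -val_eqE/= ltn_eqF.
have ule l : (u l <= k)%N = (l <= k)%N.
  by rewrite /u; case: tpermP => [->|->|//]; rewrite (ltnW ik) (ltnW jk).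
rewrite /star_law (reindex_inj (@perm_inj _ u))/=.
under eq_bigl do rewrite ule.
apply: eq_bigr => l _; congr (_ * (_ %:R)).
by rewrite -[X in tperm _ X]uk -tpermJ (inj_eq (conjg_inj u)).
Qed.

(* Conjugation by an element of the smaller symmetric group permutes the
   transpositions of the larger star. *)
Lemma star_law_comm (R : realType) {n : nat} (j k : 'I_n) :
  convolution (star_law R j) (star_law R k) =
  convolution (star_law R k) (star_law R j).
Proof.
wlog jk : j k / (j <= k)%N.
  by move=> H; have [/H//|/ltnW/H ->] := leqP j k.
have [<-//|njk] := eqVneq j k.
have {njk}jk : (j < k)%N by rewrite ltn_neqAle jk andbT.
apply/funext => g; rewrite /convolution.
have inj : injective (fun h : {perm 'I_n} => (g * h^-1)%g).
  by move=> x y /mulgI/invg_inj.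
(* Pairing [h] on the left with [g * h^-1] on the right leaves the common factor [star_law R j h];
   the other arguments, [h^-1 * g] and [g * h^-1], are conjugate by [h]. *)
rewrite [RHS](reindex_inj inj)/=; apply: eq_bigr => h _.
rewrite invMg invgK mulgKV mulrC.
have [->|] := eqVneq (star_law R j h) 0; first by rewrite !mulr0.
move=> hn0; congr (_ * _).
have [i ij ->] : exists2 i : 'I_n, (i <= j)%N & h = tperm i j.
  have [[i /andP[ij /eqP hE]]|H] := pselect (exists i : 'I_n,
    ((i <= j)%N && (tperm i j == h))); first by exists i.
  move/negP: hn0; case; apply/eqP; apply: big1 => i ij.
  case: eqP => [E|]; last by rewrite mulr0.
  by case: H; exists i; rewrite ij E eqxx.
rewrite -[RHS](@star_lawJ R n k i j _ (leq_ltn_trans ij jk) jk).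
by rewrite conjgE mulgKV.
Qed.

(** The uniform law on the copy of the symmetric group of degree [m] that fixes every position from
    [m] on. *)
Definition uniform_below (R : realType) (n m : nat) : {perm 'I_n} -> R :=
  fun s => [forall i : 'I_n, (m <= i)%N ==> (s i == i)]%:R / m`!%:R.

Lemma uniform_below0 (R : realType) (n : nat) :
  uniform_below R n 0 = dirac_law 1%g.
Proof.
apply/funext => s; rewrite /uniform_below /dirac_law fact0 divr1.
congr (_%:R); apply: congr1; apply/forallP/eqP => [H|-> i].
  by apply/permP => i; rewrite perm1; apply/eqP/H.
by rewrite perm1 eqxx implybT.
Qed.

Lemma uniform_below_full (R : realType) (n : nat) :
  uniform_below R n n = uniform_dist R.
Proof.
apply/funext => s; rewrite /uniform_below /uniform_dist.
rewrite (_ : [forall i, _]); last first.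
  by apply/forallP => i; rewrite leqNgt ltn_ord.
by rewrite mul1r -card_Sn.
Qed.

(** Coset decomposition: if [g] fixes all positions above [k], exactly one [i <= k] makes
    [tperm i k * g] fix [k] as well, namely the preimage of [k] under [g]. So [g] receives mass
    1/(k+1) times 1/k!. *)
Lemma star_law_uniform_below (R : realType) {n : nat} (k : 'I_n) :
  convolution (star_law R k) (uniform_below R n k) = uniform_below R n k.+1.
Proof.
apply/funext => g; rewrite /convolution /star_law.
under eq_bigr do rewrite mulr_suml.
rewrite exchange_big/=.
under eq_bigr => i ik.
  rewrite (bigD1 (tperm i k))//= eqxx mulr1 big1 ?addr0; last first.
    by move=> s; rewrite eq_sym => /negbTE ->; rewrite mulr0 mul0r.
  rewrite tpermV; over.
rewrite /uniform_below.
pose B := [forall l : 'I_n, (k < l)%N ==> (g l == l)]; rewrite -/B.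
have fixE (i : 'I_n) : (i <= k)%N ->
  [forall l : 'I_n, (k <= l)%N ==> ((tperm i k * g)%g l == l)] =
  B && (i == (g^-1)%g k).
  move=> ik; apply/forallP/andP => [H|[/forallP H /eqP iE] l].
    split.
      apply/forallP => l; apply/implyP => kl.
      have := H l; rewrite (ltnW kl)/= permM tpermD//; rewrite -val_eqE/=.
        by rewrite ltn_eqF// (leq_ltn_trans ik).
      by rewrite ltn_eqF.
    by have := H k; rewrite leqnn/= permM tpermR => /eqP <-; rewrite permK.
  apply/implyP; rewrite leq_eqVlt => /orP[/eqP/val_inj <-|kl].
    by rewrite permM tpermR iE permKV.
  have := H l; rewrite kl/= permM tpermD//; rewrite -val_eqE/=.
    by rewrite ltn_eqF// (leq_ltn_trans ik).
  by rewrite ltn_eqF.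
under eq_bigr => i ik do rewrite fixE//.
case: (boolP B) => [/forallP H|_]; last first.
  by rewrite [RHS]mul0r big1 // => i _; rewrite /= mul0r mulr0.
have gk : ((g^-1)%g k <= k)%N.
  rewrite leqNgt; apply/negP => lt.
  have /eqP := implyP (H ((g^-1)%g k)) lt; rewrite permKV => E.
  by rewrite -E ltnn in lt.
rewrite (bigD1 ((g^-1)%g k))//= eqxx big1 ?addr0; last first.
  by move=> i /andP[_ /negbTE ->]; rewrite mul0r mulr0.
by rewrite factS natrM invfM !mul1r.
Qed.

(** The Fisher-Yates shuffle, by induction on [m]: the letter with value [m] is carried to the front
    by commutation, the rest of the word still contains all smaller letters, and one more star
    enlarges the uniform factor. *)
Lemma word_law_star_prefix (R : realType) {n : nat} (m : nat) (w : seq 'I_n) :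
  (m <= n)%N -> (forall j : 'I_n, (j < m)%N -> j \in w) ->
  exists w', word_law (star_law R) w =
    convolution (uniform_below R n m) (word_law (star_law R) w').
Proof.
elim: m w => [|m IH] w mn wm.
  exists w; rewrite uniform_below0 convolution_dirac invg1.
  by under [RHS]eq_fun do rewrite mul1g.
pose k := Ordinal mn.
have [|j jm|w' w'E] := IH (rem k w); first exact: ltnW.
  apply: rem_mem; first by rewrite -val_eqE/= ltn_eqF.
  by apply: wm; rewrite ltnS ltnW.
exists w'; rewrite (@word_law_rem _ _ _ _ _ k); [|exact: star_law_comm|exact: wm].
by rewrite w'E convolutionA (star_law_uniform_below R k).
Qed.

Lemma word_law_star_full (R : realType) {n : nat} (w : seq 'I_n) :
  (forall j, j \in w) -> word_law (star_law R) w = uniform_dist R.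
Proof.
move=> wf.
have [w' ->] := @word_law_star_prefix R n n w (leqnn n) (fun j _ => wf j).
rewrite uniform_below_full convolution_uniform//.
by apply: word_law_law => j; exact: star_law_law.
Qed.

Lemma tv_dist_OST_le (R : realType) (n t : nat) : (0 < n)%N ->
  tv_dist (convolution_pow (OST R n) t) (uniform_dist R) <=
  n%:R * (1 - n%:R^-1) ^+ t.
Proof.
move=> n0; apply: tv_dist_le => A; have wl := ord_law R n0.
pose p := fun _ : 'I_n => n%:R^-1 : R.
under eq_bigr do rewrite (@convolution_pow_words _ _ _ _ p _ _ _ (@OST_star R n)).
rewrite -word_sum_sum.
rewrite -[X in _ - X](word_sum_cst p t _ wl) -word_sumB.
(* Union bound: a word missing some letter contributes at most 1, a full word contributes 0, and the
   sum of products counts the letters missed. *)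
apply: le_trans (_ : word_sum p t
  (fun w => \sum_j \prod_(x <- w) (x != j)%:R) <= _).
  apply: norm_word_sum_le => // w.
  have [/forallP wf|/forallPn[j jw]] := boolP [forall j, j \in w].
    rewrite word_law_star_full// subrr normr0.
    by apply: sumr_ge0 => j _; exact: prodr_ge0.
  apply: le_trans (_ : 1 <= _).
    apply: dist_itv01; apply: is_law_set_itv; last exact: uniform_dist_law.
    by apply: word_law_law => i; exact: star_law_law.
  rewrite (bigD1 j)//= big_seq big1 ?lerDl; last first.
    by move=> x xw; case: eqP => // xj; rewrite xj (negbTE jw) in xw.
  by apply: sumr_ge0 => i _; exact: prodr_ge0.
rewrite word_sum_sum.
under eq_bigr => j _.
  rewrite word_sum_prod.
  rewrite (_ : \sum_x _ = 1 - n%:R^-1); first over.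
  rewrite -[X in X - _]wl.2 [in RHS](bigD1 j)//= addrAC subrr add0r.
  rewrite (bigD1 j)//= eqxx mulr0 add0r.
  by apply: eq_bigr => x ->; rewrite mulr1.
by rewrite sumr_const card_ord mulr_natl.
Qed.

(** * Lower bound *)

(* [x.1] is the position of the left hand, [x.2] that of the right hand. *)
Definition pair_weight (R : realType) {n : nat} (x : 'I_n * 'I_n) : R :=
  if (x.1 <= x.2)%N then n%:R^-1 * x.2.+1%:R^-1 else 0.

Lemma sum_pair_weight (R : realType) {n : nat} (F : 'I_n * 'I_n -> R) :
  \sum_x pair_weight R x * F x =
  \sum_(j < n) \sum_(i < n | (i <= j)%N) n%:R^-1 * j.+1%:R^-1 * F (i, j).
Proof.
under [RHS]eq_bigr do rewrite big_mkcond/=.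
rewrite exchange_big pair_bigA/=; apply: eq_bigr => -[i j] _.
by rewrite /pair_weight/=; case: ifP; rewrite ?mul0r.
Qed.

Lemma pair_weight_law (R : realType) {n : nat} : (0 < n)%N ->
  is_law (@pair_weight R n).
Proof.
move=> n0; split=> [x|].
  by rewrite /pair_weight; case: ifP => // _; rewrite mulr_ge0// invr_ge0.
have := sum_pair_weight R (fun _ : 'I_n * 'I_n => 1).
under eq_bigr do rewrite mulr1.
move=> ->; rewrite -[RHS](ord_law R n0).2; apply: eq_bigr => j _.
under eq_bigr => i _ do rewrite /= mulr1.
by rewrite -mulr_sumr sum_star_weight mulr1.
Qed.

(** With both hands recorded in the letter, the word determines the permutation, so events about
    visited positions can be read off the word. *)
Lemma OST_pair (R : realType) {n : nat} (s : {perm 'I_n}) :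
  OST R n s = \sum_x pair_weight R x * dirac_law (tperm x.1 x.2) s.
Proof.
rewrite sum_pair_weight /OST; apply: eq_bigr => j _.
rewrite big_mkcondr/=; apply: eq_bigr => i _.
by rewrite /dirac_law eq_sym; case: (s == _); rewrite ?mulr1 ?mulr0.
Qed.

Lemma word_law_dirac {R : realType} {gT : finGroupType} {X : Type}
    (f : X -> gT) (w : seq X) :
  word_law (fun x => dirac_law (R := R) (f x)) w =
  dirac_law (\prod_(x <- w) f x)%g.
Proof.
elim: w => [|x w IH] /=; first by rewrite big_nil.
rewrite IH convolution_dirac big_cons; apply/funext => g.
by rewrite /dirac_law -(inj_eq (mulgI (f x))) mulKVg.
Qed.

Lemma sum_dirac_law {R : realType} {gT : finGroupType} (a : gT) (A : {set gT}) :
  \sum_(g in A) dirac_law a g = (a \in A)%:R :> R.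
Proof.
have [aA|aA] := boolP (a \in A).
  rewrite (bigD1 a)//= /dirac_law eqxx big1 ?addr0// => g.
  by move=> /andP[_ /negbTE ->].
by apply: big1 => g gA; rewrite /dirac_law; case: eqP => // E; rewrite -E gA in aA.
Qed.

Definition meets {T : eqType} (v : T) (x : T * T) : bool :=
  (v == x.1) || (v == x.2).

Lemma prod_tperm_untouched {T : finType} (v : T) (w : seq (T * T)) :
  all (fun x => ~~ meets v x) w -> (\prod_(x <- w) tperm x.1 x.2)%g v = v.
Proof.
elim: w => [|x w IH] /=; first by rewrite big_nil perm1.
case/andP; rewrite negb_or => /andP[v1 v2] /IH wE.
by rewrite big_cons permM tpermD 1?eq_sym.
Qed.

(** The function 1 - (1 - N/a)^2 vanishes where [N] does and never exceeds 1, so it lies below [B];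
    its expectation is the left-hand side. *)
Lemma word_sum_second_moment {R : realType} {X : finType} (p : X -> R) (t : nat)
    (N B : seq X -> R) (a : R) :
  is_law p -> (forall w, 0 <= B w) -> (forall w, N w = 0 \/ B w = 1) ->
  0 < a -> word_sum p t N = a ->
  2 - word_sum p t (fun w => N w * N w) / a ^+ 2 <= word_sum p t B.
Proof.
move=> pl B0 NB a0 Na.
apply: le_trans (_ : word_sum p t
  (fun w => 2 / a * N w - (a ^+ 2)^-1 * (N w * N w)) <= _).
  rewrite word_sumB !word_sumZ Na divfK ?gt_eqF//.
  by rewrite [_ / _ ^+ 2]mulrC.
apply: le_word_sum => // w; have [->|->] := NB w.
  by rewrite mul0r !mulr0 subr0.
have -> : 2 / a * N w - (a ^+ 2)^-1 * (N w * N w) = 1 - (1 - N w / a) ^+ 2.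
  by field; rewrite gt_eqF.
by rewrite gerBl sqr_ge0.
Qed.

(** * Touching and missing the top positions *)

Lemma sum_top_positions (R : realType) (n k : nat) (c : R) : (k <= n)%N ->
  \sum_(v < n | (n - k <= v)%N) c = k%:R * c.
Proof.
move=> kn; rewrite (reindex_inj rev_ord_inj)/=.
rewrite (eq_bigl (fun i : 'I_n => (i < k)%N)); last first.
  by move=> i /=; have := ltn_ord i; lia.
by rewrite (big_ord_narrow kn) sumr_const card_ord mulr_natl.
Qed.

Definition touch_prob (R : realType) {n : nat} (v : 'I_n) : R :=
  \sum_x pair_weight R x * (meets v x)%:R.

Lemma inv_natS_le (R : realType) (n k : nat) (j : 'I_n) :
  (k < n)%N -> (n - k <= j)%N -> (j.+1%:R^-1 : R) <= (n%:R - k%:R)^-1.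
Proof.
move=> kn kj; rewrite -natrB ?(ltnW kn)// lef_pV2 ?posrE ?ltr0n ?subn_gt0//.
by rewrite ler_nat; lia.
Qed.

(** The right hand hits [v] with probability 1/n; when it is elsewhere at some j > v, the left hand
    hits [v] with probability at most 1/(n-k). Charging 1/(n-k) to all [k] top positions, [v]
    included, gives (1 + k/(n-k))/n, which is exactly 1/(n-k). *)
Lemma touch_prob_le (R : realType) {n : nat} (k : nat) (v : 'I_n) :
  (k < n)%N -> (n - k <= v)%N -> touch_prob R v <= (n%:R - k%:R)^-1.
Proof.
move=> kn kv; have n0 : (0 < n)%N by apply: leq_ltn_trans kn.
have nR : 0 < n%:R :> R by rewrite ltr0n.
have nkR : 0 < n%:R - k%:R :> R by rewrite subr_gt0 ltr_nat.
rewrite /touch_prob sum_pair_weight.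
apply: le_trans (_ : \sum_(j < n) n%:R^-1 * ((j == v)%:R +
   (if (n - k <= j)%N then (n%:R - k%:R)^-1 else 0)) <= _).
  apply: ler_sum => j _.
  under eq_bigr do rewrite -mulrA.
  rewrite -mulr_sumr; apply: ler_wpM2l; first by rewrite invr_ge0 ltW.
  have [->|jv] := eqVneq j v.
    rewrite kv.
    apply: (@le_trans _ _ (\sum_(i < n | (i <= v)%N) (v.+1%:R^-1 : R))).
      apply: ler_sum => i _; rewrite ler_piMr ?invr_ge0//.
      by rewrite lern1 leq_b1.
    by rewrite sum_star_weight lerDl invr_ge0 ltW.
  rewrite add0r.
  have [vj|vj] := leqP v j.
    rewrite (leq_trans kv vj) (bigD1 v)//= big1 ?addr0; last first.
      move=> i /andP[_ iv].
      by rewrite /meets/= eq_sym (negbTE iv) eq_sym (negbTE jv) mulr0.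
    apply: le_trans (inv_natS_le R _ _ j kn (leq_trans kv vj)).
    by rewrite ler_piMr ?invr_ge0// lern1 leq_b1.
  rewrite big1 => [|i ij]; first by case: ifP => // _; rewrite invr_ge0 ltW.
  have iv : (v == i) = false.
    by rewrite -val_eqE/= gtn_eqF// (leq_ltn_trans ij).
  by rewrite /meets/= iv eq_sym (negbTE jv) mulr0.
rewrite -mulr_sumr big_split/= -big_mkcond/= sum_top_positions ?(ltnW kn)//.
rewrite (bigD1 v)//= eqxx big1 ?addr0; last by move=> j /negbTE ->.
rewrite le_eqVlt; apply/orP; left; apply/eqP; rewrite mulr1n; field.
by rewrite !gt_eqF.
Qed.

(** Inclusion-exclusion: only the steps (u, v) and (v, u) touch both positions, each with weight at
    most 1/(n(n-k)), and the product of the two touch probabilities is nonnegative. *)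
Lemma pair_untouched_le (R : realType) {n : nat} (k : nat) (u v : 'I_n) :
  (k < n)%N -> (n - k <= u)%N -> (n - k <= v)%N -> u != v ->
  \sum_x pair_weight R x * ((~~ meets u x)%:R * (~~ meets v x)%:R) <=
  (1 - touch_prob R u) * (1 - touch_prob R v) +
  2 / (n%:R * (n%:R - k%:R)).
Proof.
move=> kn ku kv uv; have n0 : (0 < n)%N by apply: leq_ltn_trans kn.
have nR : 0 < n%:R :> R by rewrite ltr0n.
have nkR : 0 < n%:R - k%:R :> R by rewrite subr_gt0 ltr_nat.
have [w0 w1] := @pair_weight_law R n n0.
have t0 (x : 'I_n) : 0 <= touch_prob R x :> R.
  by apply: sumr_ge0 => i _; apply: mulr_ge0; [exact: w0|exact: ler0n].
have -> : \sum_x pair_weight R x * ((~~ meets u x)%:R * (~~ meets v x)%:R) =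
    1 - touch_prob R u - touch_prob R v +
    \sum_x pair_weight R x * (meets u x && meets v x)%:R.
  rewrite -[X in X - _ - _]w1 /touch_prob -!sumrB -big_split/=.
  apply: eq_bigr => x _; by case: (meets u x); case: (meets v x) => /=; rewrite ?mulr1n ?mulr0n; ring.
suff : \sum_x pair_weight R x * (meets u x && meets v x)%:R <=
    2 / (n%:R * (n%:R - k%:R)).
  by move=> H; have := mulr_ge0 (t0 u) (t0 v); lra.
apply: le_trans (_ : pair_weight R (u, v) + pair_weight R (v, u) <= _).
  rewrite (bigD1 (u, v))//= (bigD1 (v, u))/=; last first.
    by apply/eqP => -[E _]; rewrite E eqxx in uv.
  rewrite addrA big1 ?addr0 => [|[i j] /andP[/= xuv xvu]].
    by apply: lerD; rewrite ler_piMr// lern1 leq_b1.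
  case: (boolP (_ && _)); last by rewrite mulr0.
  rewrite /meets/= => /andP[/orP[]/eqP ui /orP[]/eqP vj]; move: uv xuv xvu;
    by rewrite ui vj !eqxx.
have wle (i j : 'I_n) : (n - k <= j)%N ->
    pair_weight R (i, j) <= (n%:R * (n%:R - k%:R))^-1.
  move=> kj; rewrite /pair_weight; case: ifP => _.
    by rewrite invfM ler_wpM2l ?invr_ge0 ?inv_natS_le// ltW.
  by rewrite invr_ge0 mulr_ge0// ltW.
have := wle u v kv; have := wle v u ku; lra.
Qed.

(** Composing with the transposition of [v] and [i] shows that all images of [v] are equally
    likely. *)
Lemma uniform_fix_point (R : realType) {n : nat} (v : 'I_n) :
  \sum_(s : {perm 'I_n} | s v == v) uniform_dist R s = n%:R^-1.
Proof.
pose f i := \sum_(s : {perm 'I_n} | s v == i) uniform_dist R s.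
have fE i : f i = f v.
  rewrite /f (reindex_inj (mulIg (tperm v i)))/=; apply: eq_bigl => s.
  by rewrite permM -{2}(tpermL v i) (inj_eq perm_inj).
have : \sum_i f i = 1.
  rewrite -(uniform_dist_law R {perm 'I_n}).2.
  by rewrite [RHS](partition_big (fun s : {perm 'I_n} => s v) xpredT).
under eq_bigr do rewrite fE.
rewrite sumr_const card_ord -[_ *+ _]mulr_natr => H.
have n0 : n%:R != 0 :> R.
  by rewrite pnatr_eq0 -lt0n (leq_ltn_trans _ (ltn_ord v)).
by rewrite -[LHS]/(f v) -[LHS](mulfK n0) H mul1r.
Qed.

(** The event that tells the walk apart from the uniform law. *)
Definition fixes_top (n k : nat) : {set {perm 'I_n}} :=
  [set s : {perm 'I_n} | [exists v : 'I_n, (n - k <= v)%N && (s v == v)]].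

Lemma uniform_fixes_top (R : realType) (n k : nat) : (k <= n)%N ->
  \sum_(s in fixes_top n k) uniform_dist R s <= k%:R / n%:R.
Proof.
move=> kn; rewrite -(sum_top_positions R n k)//.
apply: le_trans (_ : \sum_(v < n | (n - k <= v)%N)
  \sum_(s : {perm 'I_n} | s v == v) uniform_dist R s <= _); last first.
  by apply: ler_sum => v _; rewrite uniform_fix_point.
rewrite big_mkcond/=.
under [leRHS]eq_bigr do rewrite big_mkcond/=.
rewrite [leRHS]exchange_big/=; apply: ler_sum => s _.
have u0 := (uniform_dist_law R {perm 'I_n}).1 s.
have g0 (v : 'I_n) : 0 <= (if s v == v then uniform_dist R s else 0).
  by case: ifP.
rewrite inE; case: existsP => [[v /andP[kv sv]]|_]; last exact: sumr_ge0.
rewrite (bigD1 v)//= sv lerDl; exact: sumr_ge0.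
Qed.

(** Second moment method for the number [N] of untouched top positions. With [r] = 1 - 1/(n-k) and
    [D] the exponential, E N is at least k r^t and E N^2 is at most E N + (E N)^2 D. *)
Lemma OST_fixes_top (R : realType) (n k t : nat) :
  (0 < k)%N -> (k + 2 <= n)%N ->
  2 - expR (8 * t%:R / (n%:R * (n%:R - k%:R)))
    - (k%:R * (1 - (n%:R - k%:R)^-1) ^+ t)^-1 <=
  \sum_(s in fixes_top n k) convolution_pow (OST R n) t s.
Proof.
move=> k0 k2n; have kn : (k < n)%N by lia.
have n0 : (0 < n)%N by lia.
have nR : 0 < n%:R :> R by rewrite ltr0n.
have kR : 0 < k%:R :> R by rewrite ltr0n.
have nk2 : 2 <= n%:R - k%:R :> R.
  by rewrite lerBrDl -natrD ler_nat.
have nkR : 0 < n%:R - k%:R :> R by lra.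
set m : R := n%:R - k%:R in nk2 nkR *.
set r := 1 - m^-1; set D := expR _.
have mV : m^-1 <= 2^-1 by rewrite lef_pV2 ?posrE.
have r2 : 2^-1 <= r by rewrite /r; lra.
have r0 : 0 < r by lra.
pose p := @pair_weight R n.
have pl : is_law p by exact: pair_weight_law.
pose U (v : 'I_n) (w : seq ('I_n * 'I_n)) : R :=
  \prod_(x <- w) (~~ meets v x)%:R.
pose N w := \sum_(v < n | (n - k <= v)%N) U v w.
pose q (v : 'I_n) := 1 - touch_prob R v.
have qr (v : 'I_n) : (n - k <= v)%N -> r <= q v.
  by move=> kv; rewrite lerB// touch_prob_le.
have EU v : word_sum p t (U v) = q v ^+ t.
  rewrite word_sum_prod; congr (_ ^+ _).
  rewrite /q /touch_prob -[X in X - _]pl.2 -sumrB.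
  by apply: eq_bigr => x _; case: meets; rewrite /p /= ?mulr1n ?mulr0n; ring.
set a := word_sum p t N.
have aE : a = \sum_(v < n | (n - k <= v)%N) q v ^+ t.
  by rewrite /a word_sum_sum; apply: eq_bigr.
have ar : k%:R * r ^+ t <= a.
  rewrite aE -(sum_top_positions _ _ _ _ (ltnW kn)); apply: ler_sum => v kv.
  by apply: lerXn2r; rewrite ?nnegrE ?qr// ?ltW// (lt_le_trans r0) ?qr.
have krt0 : 0 < k%:R * r ^+ t by rewrite mulr_gt0// exprn_gt0.
have a0 : 0 < a by apply: lt_le_trans ar.
have EUU (u v : 'I_n) : (n - k <= u)%N -> (n - k <= v)%N -> u != v ->
    word_sum p t (fun w => U u w * U v w) <= q u ^+ t * q v ^+ t * D.
  move=> ku kv uv.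
  under eq_word_sum => w do rewrite /U -big_split/=.
  rewrite word_sum_prod.
  have qu := qr _ ku; have qv := qr _ kv.
  have quv : r * r <= q u * q v by rewrite ler_pM// ltW.
  (* Since [r >= 1/2], the product [q u * q v] is at least 1/4, so the additive error 2/(nm) is at
     most [q u * q v] times 8/(nm). Then 1 + h <= exp h turns it into a factor per step. *)
  apply: le_trans (_ : (q u * q v * expR (8 / (n%:R * m))) ^+ t <= _).
    apply: lerXn2r; rewrite ?nnegrE.
    - by apply: sumr_ge0 => x _; rewrite !mulr_ge0// pl.1.
    - by rewrite mulr_ge0 ?expR_ge0// (le_trans _ quv)// mulr_ge0// ltW.
    - apply: le_trans (pair_untouched_le R k u v kn ku kv uv) _.
      rewrite -/m -/(q u) -/(q v).
      have h0 : 0 <= 8 / (n%:R * m) by rewrite divr_ge0// mulr_ge0// ltW.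
      have e1 := expR_ge1Dx (8 / (n%:R * m)).
      have -> : 2 / (n%:R * m) = 4^-1 * (8 / (n%:R * m)) by field; rewrite !gt_eqF.
      have qq4 : 4^-1 <= q u * q v by apply: le_trans quv; nra.
      nra.
  rewrite !exprMn -expRM_natl /D.
  by rewrite (_ : t%:R * _ = 8 * t%:R / (n%:R * m)) //; ring.
(* The diagonal terms add up to at most [a], as [U] takes values in [0, 1]; the others are bounded
   by [EUU], and the missing diagonal is put back. *)
have ENN : word_sum p t (fun w => N w * N w) <= a + a ^+ 2 * D.
  rewrite (eq_word_sum _ _ _ (fun w => \sum_(u < n | (n - k <= u)%N)
    \sum_(v < n | (n - k <= v)%N) U u w * U v w)); last first.
    by move=> w; rewrite /N mulr_suml; apply: eq_bigr => u _; rewrite mulr_sumr.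
  rewrite word_sum_sum expr2 [in X in _ + X]aE -mulrA mulr_suml [X in X + _]aE.
  rewrite -big_split/=; apply: ler_sum => u ku.
  rewrite word_sum_sum (bigD1 u)//=; apply: lerD.
    rewrite -EU; apply: le_word_sum => // w.
    rewrite -[leRHS]mulr1 /U ler_wpM2l ?prodr_ge0//.
    by apply: prodr_ile1 => x _; rewrite ler0n lern1 leq_b1.
  rewrite mulr_suml mulr_sumr [leRHS](bigD1 u)//=.
  apply: ler_wpDl.
    by rewrite !mulr_ge0 ?expR_ge0 ?exprn_ge0// (le_trans (ltW r0) (qr _ ku)).
  apply: ler_sum => v /andP[kv vu]; rewrite mulrA; apply: EUU => //.
  by rewrite eq_sym.
have -> : \sum_(s in fixes_top n k) convolution_pow (OST R n) t s =
    word_sum p t (fun w =>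
      ((\prod_(x <- w) tperm x.1 x.2)%g \in fixes_top n k)%:R).
  under eq_bigr do rewrite (@convolution_pow_words _ _ _ _ p _ _ _ (@OST_pair R n)).
  rewrite -word_sum_sum; apply: eq_word_sum => w.
  by rewrite word_law_dirac sum_dirac_law.
apply: le_trans (word_sum_second_moment p t N _ a pl _ _ a0 erefl).
- have -> : 2 - D - (k%:R * r ^+ t)^-1 = 2 - (D + (k%:R * r ^+ t)^-1) by ring.
  rewrite lerB// ler_pdivrMr ?exprn_gt0//.
  apply: le_trans ENN _; rewrite mulrDl addrC [D * _]mulrC lerD2l.
  have aV : a^-1 <= (k%:R * r ^+ t)^-1 by rewrite lef_pV2 ?posrE.
  apply: le_trans (_ : a^-1 * a ^+ 2 <= _).
    by rewrite expr2 mulKf ?gt_eqF.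
  by rewrite ler_wpM2r// ltW// exprn_gt0.
- by move=> w.
(* Either some top position is untouched and hence fixed, or every term of [N] has a zero factor. *)
- move=> w; case: (boolP [exists v : 'I_n, (n - k <= v)%N &&
      all (fun x => ~~ meets v x) w]).
    move=> /existsP[v /andP[kv vw]]; right.
    rewrite inE (_ : [exists _, _])//; apply/existsP; exists v.
    by rewrite kv prod_tperm_untouched ?eqxx.
  rewrite negb_exists => /forallP H; left; apply: big1 => v kv.
  have := H v; rewrite kv /= => /allPn[x xw]; rewrite negbK => vx.
  by rewrite /U (big_rem _ xw)/= vx mul0r.
Qed.

Lemma tv_dist_OST_ge (R : realType) (n k t : nat) :
  (0 < k)%N -> (k + 2 <= n)%N ->
  2 - expR (8 * t%:R / (n%:R * (n%:R - k%:R)))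
    - (k%:R * (1 - (n%:R - k%:R)^-1) ^+ t)^-1 - k%:R / n%:R <=
  tv_dist (convolution_pow (OST R n) t) (uniform_dist R).
Proof.
move=> k0 k2n.
have H := OST_fixes_top R n k t k0 k2n.
have H' : \sum_(s in fixes_top n k) uniform_dist R s <= k%:R / n%:R :> R.
  by apply: uniform_fixes_top; lia.
apply: le_trans (tv_dist_ge _ _ (fixes_top n k)).
apply: le_trans (ler_norm _).
by apply: lerB.
Qed.

(** * Asymptotics *)

(** From 1 - 1/n <= exp(-1/n). Rounding the time down loses less than one step, hence the 1/n in the
    exponent. *)
Lemma OST_upper (R : realType) (n : nat) (x : R) : (0 < n)%N ->
  tv_dist (convolution_rpow (OST R n) (n%:R * ln n%:R + x * n%:R))
    (uniform_dist R) <= expR (n%:R^-1 - x).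
Proof.
move=> n0; have nR : 0 < n%:R :> R by rewrite ltr0n.
rewrite /convolution_rpow; set T := _ + _; set t := Num.truncn T.
apply: le_trans (tv_dist_OST_le R n t n0) _.
have Tt : T < t%:R + 1 by rewrite natr1; exact: truncnS_gt.
have n1 : 0 <= 1 - n%:R^-1 :> R by rewrite subr_ge0 invf_le1// ler1n.
apply: le_trans (_ : n%:R * expR (- n%:R^-1) ^+ t <= _).
  rewrite ler_wpM2l ?ler0n// lerXn2r ?nnegrE ?expR_ge0//.
  by have := expR_ge1Dx (- n%:R^-1 : R).
rewrite -expRM_natl -[X in X * _](lnK (x := n%:R)) ?posrE// -expRD ler_expR.
have -> : n%:R^-1 - x = ln n%:R + (1 - T) / n%:R.
  by rewrite /T; field; rewrite gt_eqF.
by rewrite lerD2l mulrN -mulNr ler_pM2r ?invr_gt0//; lra.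
Qed.

Lemma sqr_le_expR (R : realType) (x : R) : 0 <= x -> x ^+ 2 <= expR x.
Proof.
move=> x0; have -> : x = 2 * (x / 2) by field.
rewrite expRM_natl lerXn2r ?nnegrE ?expR_ge0//; first by lra.
(* Here exp 1 >= 2 and exp(x/2 - 1) >= x/2, so exp(x/2) >= x. *)
have -> : x / 2 = 1 + (x / 2 - 1) by ring.
rewrite expRD; have e1 := expR_ge1Dx (1 : R).
have e2 := expR_ge1Dx (x / 2 - 1).
have := ler_pM _ _ e1 e2; nra.
Qed.

Lemma expR_le_1D2x (R : realType) (d : R) :
  0 <= d -> d <= 2^-1 -> expR d <= 1 + 2 * d.
Proof.
move=> d0 d2; have e1 := expR_ge1Dx (- d).
have e2 : expR d * expR (- d) = 1 by rewrite -expRD subrr expR0.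
have e3 := expR_gt0 d; nra.
Qed.

(** The inverse of 1 - 1/m is 1 + 1/(m-1), which is at most exp(1/(m-1)). *)
Lemma expRN_le_1BV (R : realType) (m : R) :
  1 < m -> expR (- (m - 1)^-1) <= 1 - m^-1.
Proof.
move=> m1; rewrite expRN -[leRHS]invrK lef_pV2 ?posrE ?expR_gt0//; last first.
  by rewrite invr_gt0 subr_gt0 invf_lt1//; lra.
apply: le_trans (expR_ge1Dx _).
rewrite le_eqVlt; apply/orP; left; apply/eqP; field.
by rewrite !gt_eqF//; lra.
Qed.

(** Here [x] stands for c - 2 and k is the floor of n / ln n. The loss 2/(3x^2) splits into 3/(5x^2)
    for the inverse mean and [e] = 1/(30x^2) for each of two errors: the correlation factor minus 1,
    and k/n. *)
Lemma OST_lower (R : realType) (n t : nat) (x : R) :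
  let L := ln n%:R : R in let e := (30 * x ^+ 2)^-1 in
  0 < x -> 16 <= L -> 100 * L <= n%:R -> 32 * L <= e * n%:R -> 1 <= e * L ->
  t%:R <= n%:R * (L - ln L - (x + 2)) ->
  1 - 2 / (3 * x ^+ 2) <=
  tv_dist (convolution_pow (OST R n) t) (uniform_dist R).
Proof.
move=> L e x0 L16 LN LeN eL; set N : R := n%:R in LN LeN *.
set y := L - ln L - (x + 2) => ty.
have L0 : 0 < L by lra.
have N0 : 0 < N by lra.
have e0 : 0 < e by rewrite invr_gt0 mulr_gt0// exprn_gt0.
pose k := Num.truncn (N / L); set K : R := k%:R.
have K0 : 0 <= K by exact: ler0n.
have KL : K * L <= N by rewrite -ler_pdivlMr// truncn_le divr_ge0// ltW.
have NK : N < (K + 1) * L by rewrite -ltr_pdivrMr// natr1 truncnS_gt.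
have K99 : 99 < K by nra.
have K16 : 16 * K <= N by nra.
have k0 : (0 < k)%N by rewrite -(ltr0n R) -/K; lra.
have k2 : (k + 2 <= n)%N by rewrite -(ler_nat R) natrD -/K -/N; lra.
have lnL0 : 0 <= ln L by rewrite ln_ge0//; lra.
have yL : y <= L by rewrite /y; lra.
apply: le_trans (tv_dist_OST_ge R n k t k0 k2); rewrite -/K -/N.
have t0 : 0 <= t%:R :> R by exact: ler0n.
(* As t <= N L and N - K >= N/2, the exponent is at most 16 L/N, and exp d <= 1 + 2d leaves 32 L/N
   <= e. *)
have D1 : expR (8 * t%:R / (N * (N - K))) <= 1 + e.
  apply: le_trans (_ : expR (16 * L / N) <= _).
    rewrite ler_expR ler_pdivrMr; last by rewrite mulr_gt0//; lra.
    have -> : 16 * L / N * (N * (N - K)) = 16 * L * (N - K).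
      by field; rewrite gt_eqF.
    by nra.
  have d0 : 0 <= 16 * L / N by rewrite divr_ge0//; lra.
  have d1 : 16 * L / N <= 2^-1 by rewrite ler_pdivrMr//; lra.
  apply: le_trans (expR_le_1D2x _ _ d0 d1) _.
  by rewrite lerD2l !mulrA ler_pdivrMr//; lra.
have D2 : K / N <= e by rewrite ler_pdivrMr//; nra.
have D3 : (K * (1 - (N - K)^-1) ^+ t)^-1 <= 3 / (5 * x ^+ 2).
  have -> : 3 / (5 * x ^+ 2) = (5 / 3 * x ^+ 2)^-1.
    by field; rewrite gt_eqF.
  have xx : 0 < x ^+ 2 by rewrite exprn_gt0.
  have m1 : 1 < N - K by lra.
  have r0 := expRN_le_1BV _ _ m1.
  suff H : 5 / 3 * x ^+ 2 <= K * expR (- (N - K - 1)^-1) ^+ t.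
    have H' : 5 / 3 * x ^+ 2 <= K * (1 - (N - K)^-1) ^+ t.
      apply: le_trans H _; rewrite ler_wpM2l// lerXn2r// nnegrE ?expR_ge0//.
      by apply: le_trans r0; rewrite expR_ge0.
    by rewrite lef_pV2 ?posrE//; lra.
  rewrite -expRM_natl.
  (* Replacing N by N - K - 1 in the exponent adds about y K/N, which is at most 1 because y <= L
     and K L <= N; 5/4 leaves room for the rounding. *)
  apply: le_trans (_ : K * expR (- (y + 5 / 4)) <= _); last first.
    rewrite ler_wpM2l// ler_expR mulrN lerN2 ler_pdivrMr; last by lra.
    by nra.
  (* The bound becomes (K L/N) exp(x + 3/4), with K L/N >= 99/100 and exp(x + 3/4) >= (7/4) x^2; the
     product of the constants exceeds 5/3. *)
  have -> : - (y + 5 / 4) = ln L - L + (x + 3 / 4) by rewrite /y; field.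
  rewrite !expRD expRN !lnK ?posrE//.
  have x1 := sqr_le_expR _ _ (ltW x0).
  have x2 := expR_ge1Dx (3 / 4 : R).
  have x3 : 7 / 4 * x ^+ 2 <= expR x * expR (3 / 4) by nra.
  have KLN : 99 / 100 <= K * (L / N).
    by rewrite mulrA ler_pdivlMr//; nra.
  rewrite mulrA; nra.
have eE : 2 / (3 * x ^+ 2) = 3 / (5 * x ^+ 2) + 2 * e.
  by rewrite /e; field; rewrite gt_eqF.
rewrite eE; lra.
Qed.

(** * Limits superior and inferior, growth of logarithms *)

Lemma limn_esup_le_near (R : realType) (u : nat -> \bar R) (b : \bar R) :
  (\forall n \near \oo, (u n <= b)%E) -> (limn_esup u <= b)%E.
Proof.
move=> ub; apply: (@le_trans _ _ (ereal_sup (u @` [set n | (u n <= b)%E]))).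
  by apply: ereal_inf_lbound; exists [set n | (u n <= b)%E].
by apply: ge_ereal_sup => _ [n /= un <-].
Qed.

Lemma limn_einf_ge_near (R : realType) (u : nat -> \bar R) (b : \bar R) :
  (\forall n \near \oo, (b <= u n)%E) -> (b <= limn_einf u)%E.
Proof.
move=> ub; rewrite /limn_einf leeNr; apply: limn_esup_le_near.
by near do rewrite leeNl oppeK.
Unshelve. all: by end_near. Qed.

Lemma near_natr_ge (R : realType) (M : R) : \forall n \near \oo, M <= n%:R.
Proof. exact: nbhs_infty_ger. Qed.

Lemma ln_ge_natr_near (R : realType) (M : R) :
  \forall n \near \oo, M <= ln n%:R.
Proof.
near=> n; have Mn : expR M <= n%:R by near: n; exact: near_natr_ge.
by rewrite -[M]expRK ler_ln ?posrE ?expR_gt0// (lt_le_trans _ Mn) ?expR_gt0.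
Unshelve. all: by end_near. Qed.

Lemma ln_ln_ge_natr_near (R : realType) (M : R) :
  \forall n \near \oo, M <= ln (ln n%:R).
Proof.
near=> n; have Mn : expR M <= ln n%:R by near: n; exact: ln_ge_natr_near.
by rewrite -[M]expRK ler_ln ?posrE ?expR_gt0// (lt_le_trans _ Mn) ?expR_gt0.
Unshelve. all: by end_near. Qed.

(** From exp l >= 1 + l^2/2 at l = ln x one gets (ln x)^2 < 2x, and 2x <= (e x)^2 for such [x]. *)
Lemma ln_le_mulr (R : realType) (e x : R) :
  0 < e -> 1 <= x -> 2 / e ^+ 2 <= x -> ln x <= e * x.
Proof.
move=> e0 x1 ex; have x0 : 0 < x by lra.
have l0 := ln_ge0 x1.
have := expR_ge1Dxn 1 l0; rewrite lnK ?posrE// (_ : 2`! = 2)%N// => H.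
rewrite leNgt; apply/negP => lt.
rewrite ler_pdivrMr ?exprn_gt0// in ex.
have : (e * x) ^+ 2 < ln x ^+ 2.
  by rewrite ltr_pXn2r// nnegrE// ltW// mulr_gt0.
have : x * 2 <= x * (x * e ^+ 2) by rewrite ler_pM2l.
rewrite exprMn; nra.
Qed.

Lemma ln_natr_le_near (R : realType) (e : R) : 0 < e ->
  \forall n \near \oo, ln n%:R <= e * n%:R.
Proof.
move=> e0; near=> n; apply: ln_le_mulr => //; near: n; exact: near_natr_ge.
Unshelve. all: by end_near. Qed.

Lemma ln_ln_natr_le_near (R : realType) (e : R) : 0 < e ->
  \forall n \near \oo, ln (ln n%:R) <= e * ln n%:R.
Proof.
move=> e0; near=> n; apply: ln_le_mulr => //; near: n; exact: ln_ge_natr_near.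
Unshelve. all: by end_near. Qed.

(** For n >= 4 the rounding factor exp(1/n) is at most exp(1/4) <= 4/3 < sqrt 2. *)
Lemma tv_dist_OST_upper_near (R : realType) (c : R) :
  \forall n \near \oo,
    tv_dist (convolution_rpow (OST R n) (n%:R * ln n%:R + c * n%:R))
      (uniform_dist R) <= Num.sqrt 2 * expR (- c).
Proof.
near=> n.
have n4 : 4 <= n%:R :> R by near: n; exact: near_natr_ge.
have n0 : (0 < n)%N by rewrite -(ltr0n R); lra.
apply: le_trans (OST_upper R n c n0) _.
rewrite expRD ler_wpM2r ?expR_ge0//.
have i4 : n%:R^-1 <= 4^-1 :> R by rewrite lef_pV2 ?posrE; lra.
apply: le_trans (_ : expR (4^-1) <= _); first by rewrite ler_expR.
have e1 : expR (4^-1) * expR (- 4^-1) = 1 :> R by rewrite -expRD subrr expR0.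
have s2 : Num.sqrt 2 ^+ 2 = 2 :> R by rewrite sqr_sqrtr.
have s0 : 0 <= Num.sqrt 2 :> R by exact: sqrtr_ge0.
have e2 := expR_ge1Dx (- 4^-1 : R).
nra.
Unshelve. all: by end_near. Qed.

(** The bound is uniform over all earlier times [T], so that it also covers the times n ln n - c' n
    ln ln n with c' >= 2 that occur in the cutoff. *)
Lemma tv_dist_OST_lower_near (R : realType) (c : R) : 2 < c ->
  \forall n \near \oo, forall T : R,
    T <= n%:R * ln n%:R - n%:R * ln (ln n%:R) - c * n%:R ->
    1 - pi ^+ 2 / (6 * (c - 2) ^+ 2) <=
    tv_dist (convolution_rpow (OST R n) T) (uniform_dist R).
Proof.
move=> c2; pose x := c - 2; have x0 : 0 < x by rewrite /x; lra.
pose e := (30 * x ^+ 2)^-1.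
have e0 : 0 < e by rewrite invr_gt0 mulr_gt0// exprn_gt0.
suff H (n : nat) (T : R) : 16 <= ln n%:R :> R -> 2 * c <= ln n%:R ->
    e^-1 <= ln n%:R -> ln n%:R <= 100^-1 * n%:R :> R ->
    ln n%:R <= (e / 32) * n%:R -> ln (ln n%:R) <= 2^-1 * ln n%:R :> R ->
    T <= n%:R * ln n%:R - n%:R * ln (ln n%:R) - c * n%:R ->
    1 - pi ^+ 2 / (6 * (c - 2) ^+ 2) <=
    tv_dist (convolution_rpow (OST R n) T) (uniform_dist R).
  near=> n => T; apply: H.
  - by near: n; exact: ln_ge_natr_near.
  - by near: n; exact: ln_ge_natr_near.
  - by near: n; exact: ln_ge_natr_near.
  - by near: n; exact: ln_natr_le_near.
  - by near: n; apply: ln_natr_le_near; rewrite divr_gt0.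
  - by near: n; exact: ln_ln_natr_le_near.
move=> L16 Lc Le LN LeN lnL TT.
(* The estimate pi >= 2 suffices, since 2/(3x^2) = 2^2/(6x^2). *)
apply: le_trans (_ : 1 - 2 / (3 * x ^+ 2) <= _).
  have p2 := pi_ge2 R.
  have xx : 0 < x ^+ 2 by rewrite exprn_gt0.
  rewrite lerB// -/x.
  rewrite (_ : 2 / (3 * x ^+ 2) = 2 ^+ 2 / (6 * x ^+ 2)); last first.
    by field; rewrite gt_eqF.
  by rewrite ler_pM2r ?invr_gt0 ?mulr_gt0// lerXn2r// ?nnegrE//; lra.
apply: OST_lower => //.
- by lra.
- by rewrite -/e; lra.
- by rewrite -/e -ler_pdivrMl// mulr1.
set T' := n%:R * _.
have n0 : 0 <= n%:R :> R by exact: ler0n.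
have TE : T <= T' by rewrite /T' /x; lra.
(* A negative [T] is truncated to 0, so the number of steps is bounded by [T'] only because [T'] is
   nonnegative. *)
have T'0 : 0 <= T' by rewrite /T' mulr_ge0// /x; lra.
apply: le_trans (_ : (Num.truncn T')%:R <= _); last by rewrite truncn_le.
by rewrite ler_nat le_truncn.
Unshelve. all: by end_near. Qed.

Lemma limn_esup_tv_dist_ge0 (R : realType) (mu nu : forall n, {perm 'I_n} -> R) :
  (0 <= limn_esup (fun n => (tv_dist (mu n) (nu n))%:E))%E.
Proof.
apply: limf_esup_ge0 => [|n]; last by rewrite lee_fin tv_dist_ge0.
exact: filter_not_empty.
Qed.

Lemma inv_sqr_small (R : realType) (p e : R) : 0 <= p -> 0 < e ->
  exists2 x, 0 < x & p / (6 * x ^+ 2) <= e.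
Proof.
move=> p0 e0; exists (p / (6 * e) + 1).
  by rewrite ltr_wpDl// divr_ge0// mulr_ge0// ltW.
set q := p / _; have q0 : 0 <= q by rewrite divr_ge0// mulr_ge0// ltW.
rewrite ler_pdivrMr; last by rewrite mulr_gt0// exprn_gt0//; lra.
have -> : p = e * (6 * q) by rewrite /q; field; rewrite gt_eqF.
by rewrite ler_pM2l//; nra.
Qed.

Theorem theorem3p1p2 (R : realType) :
  (forall c1 c2 : R, 0 < c1 -> 2 < c2 ->
     (limn_esup (fun n : nat =>
        (tv_dist
          (convolution_rpow (OST R n) (n%:R * ln n%:R + c1 * n%:R))
          (uniform_dist R))%:E)
      <= (Num.sqrt 2 * expR (- c1))%:E)%E
     /\
     ((1 - pi ^+ 2 / (6 * (c2 - 2) ^+ 2))%:E <=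
      limn_einf (fun n : nat =>
        (tv_dist
          (convolution_rpow (OST R n)
            (n%:R * ln n%:R - n%:R * ln (ln n%:R) - c2 * n%:R))
          (uniform_dist R))%:E))%E)
  /\
  tv_cutoff (fun n => {perm 'I_n} : finGroupType)
    (fun n => OST R n) (fun n => uniform_dist R)
    (fun n => n%:R * ln n%:R) (fun n => n%:R * ln (ln n%:R)).
Proof.
split=> [c1 c2 c10 c22|].
  split.
    apply: limn_esup_le_near; near do rewrite lee_fin.
    exact: tv_dist_OST_upper_near.
  apply: limn_einf_ge_near; apply: filterS (tv_dist_OST_lower_near R c2 c22).
  by move=> n; rewrite lee_fin; apply.
split.
- apply/eqoP => e e0; near=> n.
  have L1 : 1 <= ln n%:R :> R by near: n; exact: ln_ge_natr_near.
  have Le : ln (ln n%:R) <= e * ln n%:R by near: n; exact: ln_ln_natr_le_near.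
  have l0 : 0 <= ln (ln n%:R) :> R by exact: ln_ge0.
  rewrite !ger0_norm ?mulr_ge0//; last by lra.
  by rewrite mulrCA ler_wpM2l.
(* For each fixed c >= 1 the limit superior is already 0: the window exceeds every multiple of n,
   and the bound exp(1/n - c ln ln n) vanishes. *)
- apply: cvg_near_cst; near=> c.
  have c0 : 1 <= c by near: c; exact: nbhs_pinfty_ge.
  apply/eqP; rewrite eq_le limn_esup_tv_dist_ge0 andbT.
  apply/lee_addgt0Pr => e e0; rewrite add0e.
  apply: limn_esup_le_near; near=> n; rewrite lee_fin.
  have n1 : 1 <= n%:R :> R by near: n; exact: near_natr_ge.
  have n0 : (0 < n)%N by rewrite -(ltr0n R); lra.
  have lle : 1 - ln e <= ln (ln n%:R) by near: n; exact: ln_ln_ge_natr_near.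
  have ll0 : 0 <= ln (ln n%:R) :> R by near: n; exact: ln_ln_ge_natr_near.
  rewrite [_ * ln (ln _)]mulrC mulrA.
  apply: le_trans (OST_upper R n _ n0) _.
  rewrite -[leRHS]lnK ?posrE// ler_expR.
  have : n%:R^-1 <= 1 :> R by rewrite invf_le1//; lra.
  by nra.
(* For each fixed c >= 2 the limit inferior is already 1: c n ln ln n exceeds n ln ln n + (x + 2) n
   as soon as ln ln n >= x + 2, and [x] is taken so large that the defect is at most [e]. *)
- apply: cvg_near_cst; near=> c.
  have c0 : 2 <= c by near: c; exact: nbhs_pinfty_ge.
  apply/eqP; rewrite eq_le; apply/andP; split.
    apply: le_trans (limn_einf_sup _) _.
    apply: limn_esup_le_near; near=> n; rewrite lee_fin.
    have n0 : (0 < n)%N by near: n; exact: nbhs_infty_gt.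
    apply: tv_dist_le1; last exact: uniform_dist_law.
    by apply: convolution_pow_law; exact: OST_law.
  apply/lee_addgt0Pr => e e0; rewrite -leeBlDr//.
  have [x x0 xe] := inv_sqr_small R (pi ^+ 2) e (sqr_ge0 _) e0.
  have c22 : 2 < x + 2 by rewrite ltrDr.
  apply: le_trans (_ : (1 - pi ^+ 2 / (6 * (x + 2 - 2) ^+ 2))%:E <= _)%E.
    by rewrite -EFinB lee_fin lerB// addrK.
  apply: limn_einf_ge_near.
  apply: filterS2 (ln_ln_ge_natr_near R (x + 2))
    (tv_dist_OST_lower_near R (x + 2) c22).
  move=> n llc; rewrite lee_fin; apply.
  have n0 : 0 <= n%:R :> R by exact: ler0n.
  have nl := ler_wpM2l n0 llc.
  have n20 : 0 <= n%:R * (x + 2) by rewrite mulr_ge0//; lra.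
  have := ler_wpM2r (le_trans n20 nl) c0; lra.
Unshelve. all: by end_near. Qed.
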